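(* Let $\tau$ be a tricolored subdivision of $\mathbf P_n$ which contains at least one grey polygon, and let $C_\tau$ be the corresponding partial cyclic order. Then $\sum_{(w)\in\mathrm{Ext}(C_\tau)}\mathrm{PT}(w)=0$ as rational functions on the affine cone over $\mathrm{Gr}_{2,n}$.
   Context: Let $\mathbf P_n$ be a convex $n$-gon with vertices $1,\dots,n$ clockwise. A tricolored subdivision $\tau$ is a partition of $\mathbf P_n$ into polygons (vertices among those of $\mathbf P_n$) colored black, white or grey, polygons sharing an edge having different colors. A cyclic order on a finite set $X$ is a relation $C\subseteq X^3$ with $(a,b,c)\in C\Rightarrow(c,a,b)\in C$ and $(c,b,a)\notin C$, and $(a,b,c),(a,c,d)\in C\Rightarrow(a,b,d)\in C$; total if any three distinct elements are related in some orientation; $\mathrm{Ext}(C)$ is the set of total cyclic orders containing $C$. The chain $C_{(x_1,\dots,x_m)}$ is the set of $(x_a,x_b,x_c)$, $a<b<c$, and their cyclic rotations. $C_\tau$ is the union, over the black and white polygons of $\tau$ (grey ones ignored), of $C_{(v_1,\dots,v_r)}$ where $v_1,\dots,v_r$ are the polygon's vertices in clockwise order if white and counterclockwise order if black. A total cyclic order on $[n]$ is identified with an $n$-cycle $(w)=(w_1\,\cdots\,w_n)$ (elements placed clockwise on a circle). For such $w$, $\mathrm{PT}(w)=1/(P_{w_1w_2}P_{w_2w_3}\cdots P_{w_nw_1})$, where $P_{ab}$ is the minor in columns $a,b$ of a $2\times n$ matrix, with $P_{ba}=-P_{ab}$; it depends only on the cycle $(w)$. *)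

(* Defs.v *)
From HB Require Import structures.
From mathcomp Require Import all_boot all_order all_algebra.
From mathcomp Require Import fraction mpoly.
Set Implicit Arguments.
Unset Strict Implicit.
Unset Printing Implicit Defensive.
Import Order.TTheory GRing.Theory Num.Theory.
Local Open Scope ring_scope.

Section CyclicOrders.
Variable X : finType.
Implicit Types (C D : {set X * X * X}) (s : seq X).

Definition is_cyclic_order C : bool :=
  [&& [forall a, forall b, forall c, ((a, b, c) \in C) ==> ((c, a, b) \in C)],
      [forall a, forall b, forall c, ((a, b, c) \in C) ==> ((c, b, a) \notin C)]
    & [forall a, forall b, forall c, forall d,
        ((a, b, c) \in C) && ((a, c, d) \in C) ==> ((a, b, d) \in C)]].

Definition is_total_cyclic_order C : bool :=
  is_cyclic_order C &&
  [forall a, forall b, forall c,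
    uniq [:: a; b; c] ==> ((a, b, c) \in C) || ((c, b, a) \in C)].

Definition Ext C : {set {set X * X * X}} :=
  [set D | is_total_cyclic_order D & C \subset D].

Definition chain s : {set X * X * X} :=
  [set t | [exists i : 'I_(size s), exists j : 'I_(size s),
            exists k : 'I_(size s),
     let: x := tnth (in_tuple s) i in
     let: y := tnth (in_tuple s) j in
     let: z := tnth (in_tuple s) k in
     [&& (i < j)%N, (j < k)%N & t \in [:: (x, y, z); (y, z, x); (z, x, y)]]]].

End CyclicOrders.

(* The cycle (w_1 ... w_n) identified with a total cyclic order D on 'I_n: any
   word w enumerating 'I_n whose chain is D. Such a word exists (cycle_wordP)
   and is unique up to rotation, so the default value is never used on a total
   order. *)
Definition cycle_word n (D : {set 'I_n * 'I_n * 'I_n}) : n.-tuple 'I_n :=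
  odflt (ord_tuple n) [pick w : n.-tuple 'I_n | uniq w & chain w == D].

Lemma chain_nth (X : finType) (x0 : X) (s : seq X) (i j k : nat) :
  uniq s -> (i < size s)%N -> (j < size s)%N -> (k < size s)%N ->
  ((nth x0 s i, nth x0 s j, nth x0 s k) \in chain s) =
  [|| (i < j < k)%N, (j < k < i)%N | (k < i < j)%N].
Proof.
move=> us li lj lk; rewrite inE; apply/idP/idP.
  case/existsP=> -[a la] /existsP[[b lb]] /existsP[[c lc]].
  rewrite !(tnth_nth x0) !inE /= !xpair_eqE !nth_uniq //.
  case/and3P=> ab bc; rewrite -!andbA.
  by case/or3P=> /and3P[/eqP-> /eqP-> /eqP->]; rewrite ab bc ?orbT.
have ex a b c (la : (a < size s)%N) (lb : (b < size s)%N) (lc : (c < size s)%N)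
    t : (a < b < c)%N ->
    t \in [:: (nth x0 s a, nth x0 s b, nth x0 s c);
             (nth x0 s b, nth x0 s c, nth x0 s a);
             (nth x0 s c, nth x0 s a, nth x0 s b)] ->
  [exists i : 'I_(size s), exists j : 'I_(size s), exists k : 'I_(size s),
     let: x := tnth (in_tuple s) i in
     let: y := tnth (in_tuple s) j in
     let: z := tnth (in_tuple s) k in
     [&& (i < j)%N, (j < k)%N & t \in [:: (x, y, z); (y, z, x); (z, x, y)]]].
  move=> /andP[ab bc] tin; apply/existsP; exists (Ordinal la).
  apply/existsP; exists (Ordinal lb); apply/existsP; exists (Ordinal lc).
  by rewrite !(tnth_nth x0) /= ab bc.
by case/or3P=> lt3; [apply: (ex i j k) | apply: (ex j k i) | apply: (ex k i j)];
  rewrite // !inE eqxx ?orbT.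
Qed.

Lemma total_cyclic_order_word (X : finType) (D : {set X * X * X}) :
  is_total_cyclic_order D ->
  exists w : #|X|.-tuple X, uniq w /\ chain w = D.
Proof.
case/andP=> /and3P[/'forall_'forall_forallP rotD /'forall_'forall_forallP asyD].
move=> /'forall_'forall_'forall_forallP trD /'forall_'forall_forallP totD.
have {}rotD a b c : (a, b, c) \in D -> (c, a, b) \in D by apply/implyP.
have {}asyD a b c : (a, b, c) \in D -> (c, b, a) \notin D by apply/implyP.
have {}trD a b c d : (a, b, c) \in D -> (a, c, d) \in D -> (a, b, d) \in D.
  by move=> h1 h2; apply: (implyP (trD a b c d)); rewrite h1.
have {}totD a b c : uniq [:: a; b; c] -> ((a, b, c) \in D) || ((c, b, a) \in D).
  by apply/implyP.
have nD1 a c : (a, a, c) \notin D.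
  by apply/negP=> h; have := asyD _ _ _ h; rewrite (rotD _ _ _ h).
have nD2 a c : (a, c, c) \notin D.
  by apply/negP=> h; have := nD1 c a; rewrite (rotD _ _ _ (rotD _ _ _ h)).
have nD3 a c : (a, c, a) \notin D.
  by apply/negP=> h; have := nD1 a c; rewrite (rotD _ _ _ h).
suff [s us [fs sD]] : exists2 s : seq X, uniq s &
    (forall x, x \in s) /\ forall x0 i j k, (i < j < k)%N -> (k < size s)%N ->
      (nth x0 s i, nth x0 s j, nth x0 s k) \in D.
  have ss : size s == #|X|.
    by rewrite -(card_uniqP us); apply/eqP/eq_card => x; rewrite fs.
  exists (Tuple ss); split=> //=; apply/setP=> -[[x y] z].
  rewrite -(nth_index x (fs x)) -(nth_index x (fs y)) -(nth_index x (fs z)).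
  set i := index x s; set j := index y s; set k := index z s.
  have li : (i < size s)%N by rewrite index_mem.
  have lj : (j < size s)%N by rewrite index_mem.
  have lk : (k < size s)%N by rewrite index_mem.
  rewrite chain_nth //; apply/idP/idP.
    case/or3P=> h; first exact: sD.
      by apply/rotD/sD.
    by apply/rotD/rotD/sD.
  move=> xD; case: (ltngtP i j) xD => [ij|ji|->]; last by rewrite (negbTE (nD1 _ _)).
    case: (ltngtP j k) => [//|kj|->]; last by rewrite (negbTE (nD2 _ _)).
    case: (ltngtP k i) => [//|ik|->]; last by rewrite (negbTE (nD3 _ _)).
    have h : (nth x s i, nth x s k, nth x s j) \in D by apply: sD; rewrite ?ik.
    by move/asyD; rewrite (rotD _ _ _ (rotD _ _ _ (rotD _ _ _ (rotD _ _ _ (rotD _ _ _ h))))).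
  case: (ltngtP j k) => [jk|kj|->]; last by rewrite (negbTE (nD2 _ _)).
    case: (ltngtP k i) => [//|ik|->]; last by rewrite (negbTE (nD3 _ _)).
    have h : (nth x s j, nth x s i, nth x s k) \in D by apply: sD; rewrite ?ik ?ji.
    by move/asyD; rewrite (rotD _ _ _ h).
  have h : (nth x s k, nth x s j, nth x s i) \in D by apply: sD; rewrite ?kj ?ji.
  by move/asyD; rewrite h.
case: (pickP (@predT X)) => [x0 _|X0]; last first.
  by exists [::] => //; split=> // x; have := X0 x.
pose r := [rel b c | (b == c) || (b == x0) || ((x0, b, c) \in D)].
have rtot : total r.
  move=> b c; rewrite /r /=; case: (eqVneq b c) => //= bc.
  case: (eqVneq b x0) => //= bx; case: (eqVneq c x0) => //= [|cx]; first by rewrite orbT.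
  have /totD/orP[->//|/rotD h] : uniq [:: x0; b; c].
    by rewrite /= !inE negb_or eq_sym bx eq_sym cx bc.
  by rewrite h orbT.
have rtr : transitive r.
  move=> c b d; rewrite /r /=.
move=> /orP[/orP[/eqP->//|->]|bcD]; first by rewrite orbT.
  case/orP=> [/orP[/eqP<-|/eqP cx]|cdD]; first by rewrite bcD orbT.
    by rewrite cx (negbTE (nD3 _ _)) in bcD.
  by rewrite (trD _ _ _ _ bcD cdD) orbT.
exists (sort r (enum X)); first by rewrite sort_uniq enum_uniq.
split=> [x|y0 i j k /andP[ij jk] ks]; first by rewrite mem_sort mem_enum.
have us : uniq (sort r (enum X)) by rewrite sort_uniq enum_uniq.
have srt := sort_sorted rtot (enum X).
set s := sort r (enum X) in us srt ks *.
have js := ltn_trans jk ks; have is_ := ltn_trans ij js.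
have rij a b : (a < b)%N -> (b < size s)%N -> r (nth y0 s a) (nth y0 s b).
  by move=> ab bs; apply: (sorted_ltn_nth rtr) => //; rewrite inE ?(ltn_trans ab bs).
have := rij _ _ ij js; have := rij _ _ jk ks.
rewrite /r /= !nth_uniq // (ltn_eqF ij) (ltn_eqF jk) /=.
have jx : nth y0 s j != x0.
  apply/eqP=> jx; have := rij _ _ ij js.
  by rewrite /r /= -jx !nth_uniq // (ltn_eqF ij) /= (negbTE (nD3 _ _)).
rewrite (negbTE jx) /= => jkD /predU1P[->//|ijD].
by apply/rotD/(trD _ _ x0); [apply/rotD/rotD | apply: rotD].
Qed.

Lemma cycle_wordP n (D : {set 'I_n * 'I_n * 'I_n}) :
  is_total_cyclic_order D ->
  uniq (cycle_word D) /\ chain (cycle_word D) = D.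
Proof.
move=> /total_cyclic_order_word; rewrite card_ord => -[w [uw wD]].
rewrite /cycle_word; case: pickP => [v /andP[uv /eqP vD] //|/(_ w)].
by rewrite uw wD eqxx.
Qed.

Section Plane.
Variable R : realFieldType.
Local Notation plane := 'rV[R]_2.

(* Twice the signed area of the triangle a b c; negative iff a, b, c are in
   clockwise order. *)
Definition signed_area (a b c : plane) : R :=
  (b 0 0 - a 0 0) * (c 0 1 - a 0 1) - (b 0 1 - a 0 1) * (c 0 0 - a 0 0).

Variable n : nat.
Implicit Types (p : 'I_n -> plane) (A B : {set 'I_n}).

(* p lists the vertices of a (strictly) convex n-gon in clockwise order; p i
   is vertex number i + 1. *)
Definition clockwise_convex_polygon p : Prop :=
  (2 < n)%N /\
  forall i j k : 'I_n, (i < j)%N -> (j < k)%N ->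
    signed_area (p i) (p j) (p k) < 0.

(* The closed region of the polygon with vertex set A. *)
Definition region p A (x : plane) : Prop :=
  exists l : 'I_n -> R,
    [/\ forall i, i \in A -> 0 <= l i, \sum_(i in A) l i = 1
      & x = \sum_(i in A) l i *: p i].

(* Topological interior of the region, by open squares. *)
Definition region_interior p A (x : plane) : Prop :=
  exists2 e : R, 0 < e &
    forall y : plane, (forall k, `|y 0 k - x 0 k| < e) -> region p A y.

Definition is_polygon_partition p (T : {set {set 'I_n}}) : Prop :=
  [/\ forall A, A \in T -> (2 < #|A|)%N,
      forall x, region p [set: 'I_n] x <-> exists2 A, A \in T & region p A x
    & forall A B, A \in T -> B \in T -> A != B ->
        forall x, ~ (region_interior p A x /\ region_interior p B x)].

End Plane.

Definition clockwise n (a b c : 'I_n) : bool :=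
  [|| (a < b < c)%N, (b < c < a)%N | (c < a < b)%N].

(* The segment from a to b is a side of the polygon with vertex set A: no other
   vertex of A lies between a and b, along one of the two arcs. *)
Definition is_edge n (A : {set 'I_n}) (a b : 'I_n) : bool :=
  [&& a \in A, b \in A, a != b &
      [forall c in A, ~~ clockwise a c b] || [forall c in A, ~~ clockwise b c a]].

Inductive color := Black | White | Grey.

Record tricolored_subdivision (R : realFieldType) n (p : 'I_n -> 'rV[R]_2) :=
  TricoloredSubdivision {
    polygons : {set {set 'I_n}};
    color_of : {set 'I_n} -> color;
    polygons_partition : is_polygon_partition p polygons;
    edge_colors : forall A B a b, A \in polygons -> B \in polygons -> A != B ->
      is_edge A a b -> is_edge B a b -> color_of A <> color_of B }.

(* enum A is increasing, that is, clockwise. *)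
Definition polygon_order n (c : color) (A : {set 'I_n}) :
    {set 'I_n * 'I_n * 'I_n} :=
  match c with
  | White => chain (enum A)
  | Black => chain (rev (enum A))
  | Grey => set0
  end.

Definition subdivision_order (R : realFieldType) n (p : 'I_n -> 'rV[R]_2)
    (tau : tricolored_subdivision p) : {set 'I_n * 'I_n * 'I_n} :=
  \bigcup_(A in polygons tau) polygon_order (color_of tau A) A.

Section ParkeTaylor.
Variables (K : fieldType) (n : nat).

(* Rational functions in the entries of a generic 2 x n matrix. The coordinate
   ring of the affine cone over Gr(2, n) is the subring of {mpoly K[2 * n]}
   generated by the 2 x 2 minors, so its function field is a subfield. *)
Local Notation ratfun := {fraction {mpoly K[2 * n]}}.

Definition generic_mx : 'M[ratfun]_(2, n) :=
  \matrix_(i, j) FracField.tofrac ('X_(mxvec_index i j) : {mpoly K[2 * n]}).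

Definition plucker (a b : 'I_n) : ratfun :=
  \det (colsub (fun j : 'I_2 => if j == 0 then a else b) generic_mx).

Definition PT (w : n.-tuple 'I_n) : ratfun :=
  (\prod_(i < n) plucker (tnth w i) (tnth w (ordS i)))^-1.

(* PT depends only on the total cyclic order, not on the word chosen. *)
Lemma PT_chain (v w : n.-tuple 'I_n) :
  uniq v -> uniq w -> chain v = chain w -> PT v = PT w.
Proof.
move=> uv uw vw; congr (_^-1).
have /tuple_uniqP iv := uv; have /tuple_uniqP iw := uw.
pose h i := invF iv (tnth w i).
have hE i : tnth v (h i) = tnth w i by rewrite /h f_invF.
have ih : injective h by move=> i j /(congr1 (tnth v)); rewrite !hE => /iw.
rewrite (reindex h) /=; last by apply: onW_bij; apply: injF_bij.
apply: eq_bigr => i _; rewrite hE; congr (plucker _ _).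
have chE (u : n.-tuple 'I_n) (x y z : 'I_n) : uniq u ->
    ((tnth u x, tnth u y, tnth u z) \in chain u) = clockwise x y z.
  by move=> uu; rewrite !(tnth_nth i) chain_nth // size_tuple.
have next (x y : 'I_n) : y != x -> y != ordS x -> clockwise x (ordS x) y.
  case: x y => x lx [y ly]; rewrite -!val_eqE /clockwise /=.
  case: (ltngtP x.+1 n) (lx) => // [lt _|xn _].
    rewrite modn_small // ltnSn andbT; case: (ltngtP y x) => //= [_|xy] _ ny.
      by rewrite !orbT.
    by rewrite ltn_neqAle eq_sym ny xy.
  rewrite xn modnn => yx y0; have {}yx : (y < x)%N.
    by rewrite ltn_neqAle yx -ltnS xn.
  by rewrite lt0n y0 yx orbT.
have ordS_neq (x y z : 'I_n) : ordS x = x -> y = z.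
  case: x y z => x lx [y ly] [z lz] /(congr1 val) /= xS; apply: val_inj => /=.
  case: (ltngtP x.+1 n) (lx) => // [lt _|xn _].
    by move: xS; rewrite modn_small // => /eqP; rewrite gtn_eqF.
  move: xS; rewrite xn modnn => x0; move: ly lz; rewrite -xn -x0.
  by case: y z => [|y] [|z].
case: (eqVneq (tnth v (ordS (h i))) (tnth w (ordS i))) => // ne; exfalso.
have wn : tnth w i != tnth w (ordS i).
  apply: contra_neq ne => /iw /esym wi.
  by rewrite (ordS_neq i (ordS (h i)) (h i) wi) hE wi.
have vn : tnth v (h i) != tnth v (ordS (h i)).
  apply: contra_neq ne => /iv /esym wi.
  by rewrite (ordS_neq (h i) (ordS i) i wi) wi hE.
pose k := invF iw (tnth v (ordS (h i))).
pose m := invF iv (tnth w (ordS i)).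
have kE : tnth w k = tnth v (ordS (h i)) by rewrite f_invF.
have mE : tnth v m = tnth w (ordS i) by rewrite f_invF.
have ck : clockwise i (ordS i) k.
  apply: next; apply/eqP=> kk; first by rewrite -kE kk hE eqxx in vn.
  by rewrite -kE kk eqxx in ne.
have cm : clockwise (h i) (ordS (h i)) m.
  apply: next; apply/eqP=> mm; first by rewrite -mE mm hE eqxx in wn.
  by rewrite -mE mm eqxx in ne.
move: ck; rewrite -(chE w) // -vw -hE -mE kE chE // => {}ck.
move: ck cm; rewrite /clockwise.
by case: (ltngtP (h i) m); case: (ltngtP m (ordS (h i)));
  case: (ltngtP (h i) (ordS (h i))).
Qed.

End ParkeTaylor.

(* Main.v *)
(** Let [a], [b], [c] be three vertices of a grey polygon, in clockwise order.
    Any other polygon lies in one of the closed arcs [a b], [b c], [c a]: otherwise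
    it is the triangle [a b c], or the chord between two of its vertices crosses
    the interior of that triangle, and the interiors of the two polygons meet. So
    the constraints imposed by the order split into three groups, one per arc.
    Write the total cyclic orders as words starting at [a]. Interleaving words
    along their common letters multiplies Parke-Taylor factors, up to Plücker
    coordinates of the common letters; hence the arcs at [a] factor out of the
    sum. What remains is the sum over the words on the arc [b c], with [a] placed
    anywhere in the cyclic word, and this telescopes to zero. *)

Require Import Defs.
From HB Require Import structures.
From mathcomp Require Import all_boot all_order all_algebra.
From mathcomp Require Import fraction mpoly.
From mathcomp Require Import ring lra zify.
Set Implicit Arguments.
Unset Strict Implicit.
Unset Printing Implicit Defensive.
Import Order.TTheory GRing.Theory Num.Theory.
Local Open Scope ring_scope.

(** * Parke-Taylor factors of words *)

Lemma big_tuple_cons (F : nmodType) (X : finType) (k : nat)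
    (Q : pred (seq X)) (G : seq X -> F) :
  \sum_(w : k.+1.-tuple X | Q w) G w =
  \sum_(x : X) \sum_(w : k.-tuple X | Q (x :: w)) G (x :: w).
Proof.
rewrite pair_big_dep /=.
rewrite (reindex (fun q : X * k.-tuple X => [tuple of q.1 :: q.2])) //=.
exists (fun w : k.+1.-tuple X => (thead w, [tuple of behead w])) => [[x w] _|w _] /=.
  by congr pair; apply: val_inj.
by rewrite [w in RHS]tuple_eta; apply: val_inj.
Qed.

Section ParkeTaylorWords.
Variables (F : fieldType) (X : finType) (P : X -> X -> F).
Hypothesis P_anti : forall x y, P y x = - P x y.
Hypothesis P_plucker : forall x y z t,
  P x y * P z t = P x z * P y t - P x t * P y z.
Hypothesis P_neq0 : forall x y, x != y -> P x y != 0.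
Implicit Types (a b c x y : X) (u v w : seq X) (S M : {set X}).

(** [pt_path a w a] is the Parke-Taylor factor of the cycle [a :: w]; the endpoint is kept apart
    because the induction on merges moves only the starting point. *)
Fixpoint pt_path a w b : F :=
  if w is x :: w' then (P a x)^-1 * pt_path x w' b else (P a b)^-1.

Fixpoint plucker_path a w b : F :=
  if w is x :: w' then P a x * plucker_path x w' b else P a b.

Lemma pt_path_rcons a w x b :
  pt_path a (rcons w x) b = pt_path a w x * (P x b)^-1.
Proof. by elim: w a => //= y w IHw a; rewrite IHw mulrA. Qed.

Lemma pt_pathV a w b : pt_path a w b = (plucker_path a w b)^-1.
Proof. by elim: w a => //= x w IHw a; rewrite IHw invfM. Qed.

(** The three-term Plücker relation divided by [P a x * P a y * P x y]. It settles the one real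
    choice in a merge: [x] or [y] comes next, and [d] is the next common letter or the endpoint. *)
Lemma plucker_partial_fractions a x y d :
    a != x -> a != y -> x != y ->
  (P a x)^-1 * ((P x y)^-1 * P x d) + (P a y)^-1 * ((P y x)^-1 * P y d) =
  (P a x)^-1 * (P a y)^-1 * P a d.
Proof.
move=> ax ay xy; have E := P_plucker a d x y.
have [Nax Nay Nxy] := And3 (P_neq0 ax) (P_neq0 ay) (P_neq0 xy).
have -> : P a d = (P a y * P x d - P a x * P y d) / P x y.
  by apply: (canRL (mulfK Nxy)); rewrite E (P_anti x d) (P_anti y d); ring.
by rewrite (P_anti x y); field; rewrite oppr_eq0 Nxy Nay Nax.
Qed.

(** * Interleavings of two words along their common letters *)

(** Merges are described by their restrictions, so one occurrence of a common letter serves both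
    words, and order constraints on [S] or on [M] can be read off the merged word. *)
Definition is_merge S M u v w : bool :=
  [&& all (mem (S :|: M)) w, [seq x <- w | x \in S] == u
    & [seq x <- w | x \in M] == v].

Lemma is_merge_consl S M u v x w : x \in S -> x \notin M ->
  is_merge S M u v (x :: w) =
  if u is y :: u' then (x == y) && is_merge S M u' v w else false.
Proof.
move=> xS xM; rewrite /is_merge /= !inE xS (negbTE xM) /=.
case: u => [|y u]; rewrite ?andbF ?eqseq_cons //.
by case: (x == y); rewrite ?andbF.
Qed.

Lemma is_merge_sym S M u v w : is_merge S M u v w = is_merge M S v u w.
Proof. by rewrite /is_merge setUC; congr (_ && _); rewrite andbC. Qed.

Lemma is_merge_consr S M u v x w : x \notin S -> x \in M ->
  is_merge S M u v (x :: w) =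
  if v is y :: v' then (x == y) && is_merge S M u v' w else false.
Proof.
move=> xS xM; rewrite is_merge_sym is_merge_consl //.
by case: v => // y v; rewrite is_merge_sym.
Qed.

Lemma is_merge_consb S M u v x w : x \in S -> x \in M ->
  is_merge S M u v (x :: w) =
  if (u, v) is (y :: u', z :: v') then [&& x == y, x == z & is_merge S M u' v' w]
  else false.
Proof.
move=> xS xM; rewrite /is_merge /= !inE xS xM /=.
case: u => [|y u]; case: v => [|z v]; rewrite ?andbF ?eqseq_cons //.
by case: (x == y); rewrite ?andbF //; case: (x == z); rewrite ?andbF.
Qed.

Lemma is_merge_consN S M u v x w : x \notin S -> x \notin M ->
  is_merge S M u v (x :: w) = false.
Proof. by move=> xS xM; rewrite /is_merge /= inE (negbTE xS) (negbTE xM). Qed.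

Definition merge_sum S M k u v a b :=
  \sum_(w : k.-tuple X | is_merge S M u v w) pt_path a w b.

Lemma merge_sum_sym S M k u v a b :
  merge_sum S M k u v a b = merge_sum M S k v u a b.
Proof. by apply: eq_bigl => w; rewrite is_merge_sym. Qed.

Definition merge_head S M k u v a b x :=
  \sum_(w : k.-tuple X | is_merge S M u v (x :: w)) pt_path a (x :: w) b.

Lemma merge_sumS S M k u v a b :
  merge_sum S M k.+1 u v a b = \sum_x merge_head S M k u v a b x.
Proof. exact: (big_tuple_cons k (is_merge S M u v) (pt_path a ^~ b)). Qed.

Lemma merge_headE S M k u v u' v' a b x :
    (forall w, is_merge S M u v (x :: w) = is_merge S M u' v' w) ->
  merge_head S M k u v a b x = (P a x)^-1 * merge_sum S M k u' v' x b.
Proof. by move=> E; rewrite big_distrr /=; apply: eq_bigl => w; rewrite E. Qed.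

Lemma merge_head0 S M k u v a b x :
  (forall w, is_merge S M u v (x :: w) = false) -> merge_head S M k u v a b x = 0.
Proof. by move=> E; rewrite /merge_head big_pred0. Qed.

(** The head of [v], if any, lies in [S], so it cannot precede [x]; only [x] can come first. *)
Lemma merge_sum_left S M k x u v a b :
    x \in S -> x \notin M -> (if v is y :: _ then y \in S else true) ->
  merge_sum S M k.+1 (x :: u) v a b = (P a x)^-1 * merge_sum S M k u v x b.
Proof.
move=> xS xM vS; rewrite merge_sumS (bigD1 x) //= [X in _ + X]big1 ?addr0.
  by apply: merge_headE => w; rewrite is_merge_consl // eqxx.
move=> z zx; apply: merge_head0 => w.
have [zS|zS] := boolP (z \in S); have [zM|zM] := boolP (z \in M).
- by rewrite is_merge_consb // (negbTE zx); case: (v).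
- by rewrite is_merge_consl // (negbTE zx).
- rewrite is_merge_consr //; case: (v) vS => // y v' yS.
  by case: eqP zS => // ->; rewrite yS.
- by rewrite is_merge_consN.
Qed.

Lemma merge_sum_both S M k c u v a b : c \in S -> c \in M ->
  merge_sum S M k.+1 (c :: u) (c :: v) a b =
  (P a c)^-1 * merge_sum S M k u v c b.
Proof.
move=> cS cM; rewrite merge_sumS (bigD1 c) //= [X in _ + X]big1 ?addr0.
  by apply: merge_headE => w; rewrite is_merge_consb // eqxx.
move=> z zc; apply: merge_head0 => w.
have [zS|zS] := boolP (z \in S); have [zM|zM] := boolP (z \in M).
- by rewrite is_merge_consb // (negbTE zc).
- by rewrite is_merge_consl // (negbTE zc).
- by rewrite is_merge_consr // (negbTE zc).
- by rewrite is_merge_consN.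
Qed.

Lemma merge_sum_two S M k x y u v a b :
    x \in S -> x \notin M -> y \notin S -> y \in M ->
  merge_sum S M k.+1 (x :: u) (y :: v) a b =
  (P a x)^-1 * merge_sum S M k u (y :: v) x b +
  (P a y)^-1 * merge_sum S M k (x :: u) v y b.
Proof.
move=> xS xM yS yM; have yx : y != x by apply: contraNneq yS => ->.
rewrite merge_sumS (bigD1 x) //= (bigD1 y) //= [X in _ + (_ + X)]big1 ?addr0.
  congr (_ + _).
    by apply: merge_headE => w; rewrite is_merge_consl // eqxx.
  by apply: merge_headE => w; rewrite is_merge_consr // eqxx.
move=> z /andP[zx zy]; apply: merge_head0 => w.
have [zS|zS] := boolP (z \in S); have [zM|zM] := boolP (z \in M).
- by rewrite is_merge_consb // (negbTE zx).
- by rewrite is_merge_consl // (negbTE zx).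
- by rewrite is_merge_consr // (negbTE zy).
- by rewrite is_merge_consN.
Qed.

Lemma plucker_path_head a x w b :
    x != head b w ->
  plucker_path a w b = P a (head b w) * (P x (head b w))^-1 * plucker_path x w b.
Proof.
move=> /P_neq0 xh; case: w xh => [|y w] /= xh; first by rewrite mulfVK.
by rewrite mulrA mulfVK.
Qed.

(** Either [v] and [com] have the same head or both are empty; the factor at the starting point
    cancels, so the product does not depend on that point. *)
Lemma pt_path_com_head S v com a x b :
    [seq y <- v | y \in S] = com -> (if v is y :: _ then y \in S else true) ->
    a != head b com -> x != head b com ->
  pt_path a v b * plucker_path a com b = pt_path x v b * plucker_path x com b.
Proof.
case: v => [<- _ /= ab xb|y v /= <- yS]; first by rewrite !mulVf ?P_neq0.
rewrite yS /= => ay xy.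
by rewrite ![_ * _ * (P _ _ * _)]mulrACA !mulVf ?P_neq0.
Qed.

(** The invariant of the induction. The last equation makes [k] the length of a merge;
    [a != head b com] keeps a Plücker coordinate nonzero and still allows [a = b] when [com] is
    nonempty. *)
Definition merge_data S M k u v com a b : Prop :=
  [/\ all (mem S) u /\ all (mem M) v,
      [seq x <- u | x \in M] = com /\ [seq x <- v | x \in S] = com,
      uniq (a :: u) /\ uniq (a :: v), b \notin u /\ b \notin v
    & a != head b com /\ (k + size com = size u + size v)%N].

Lemma merge_data_sym S M k u v com a b :
  merge_data S M k u v com a b -> merge_data M S k v u com a b.
Proof. by case=> -[? ?] [? ?] [? ?] [? ?] [? ?]; split; split=> //; rewrite [RHS]addnC. Qed.

Lemma merge_data_left S M k x u v com a b :
    x \notin M -> merge_data S M k.+1 (x :: u) v com a b ->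
  merge_data S M k u v com x b.
Proof.
move=> xM [[/= /andP[_ uS] vM] [uC vC] [ua va] [bu bv] [ac kE]].
move: ua va => /= /and3P[_ xu uu] /andP[_ uv].
have xC : x != head b com.
  rewrite -vC; case E: [seq _ <- _ | _] => [|y s] /=.
    by apply: contraNneq bu => ->; rewrite inE eqxx.
  have: y \in [seq y <- v | y \in S] by rewrite E inE eqxx.
  rewrite mem_filter => /andP[_ /(allP vM) yM].
  by apply: contraNneq xM => ->.
split; split=> //; [by rewrite /= (negbTE xM) in uC | by rewrite cons_uniq xu | | | ].
- by rewrite cons_uniq uv andbT; apply: contraNN xM => /(allP vM).
- by apply: contraNN bu; rewrite inE => ->; rewrite orbT.
- by move: kE; rewrite /= addSn => -[].
Qed.

(* Summing over all ways of interleaving [u] and [v] along their common letters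
   multiplies the Parke-Taylor factors; the letters at which they are glued
   contribute the missing numerator. *)
Lemma merge_sumE S M k u v com a b : merge_data S M k u v com a b ->
  merge_sum S M k u v a b = pt_path a u b * pt_path a v b * plucker_path a com b.
Proof.
elim: k u v com a => [|k IHk] u v com a H.
  (* Here [size com = size u + size v], while [com] is a filter of each word, so both words are
     empty. *)
  case: H => -[uS vM] [uC vC] _ _ [ac].
  have := size_filter (mem M) u; have := count_size (mem M) u.
  have := size_filter (mem S) v; have := count_size (mem S) v.
  rewrite uC vC => h1 h2 h3 h4 h5.
  have u0 : u = [::] by apply: size0nil; lia.
  have v0 : v = [::] by apply: size0nil; lia.
  rewrite -uC {}u0 {}v0 /= in ac *.
  rewrite /merge_sum (big_pred1 [tuple]) /= ?mulfVK ?P_neq0 //.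
  by move=> w; rewrite tuple0.
(* A free letter [x] faces an empty word or a common letter, so [x] comes first. The sets are
   arbitrary so that swapping the two words gives the mirror case. *)
have free_left (S' M' : {set X}) x u' v' : x \notin M' ->
    (if v' is y :: _ then y \in S' else true) ->
    merge_data S' M' k.+1 (x :: u') v' com a b ->
    merge_sum S' M' k u' v' x b =
      pt_path x u' b * pt_path x v' b * plucker_path x com b ->
    merge_sum S' M' k.+1 (x :: u') v' a b =
      pt_path a (x :: u') b * pt_path a v' b * plucker_path a com b.
  move=> xM vS H' E; have [_ _ _ _ [xC _]] := merge_data_left xM H'.
  case: H' => -[/= /andP[xS _] _] [_ vC] _ _ [aC _].
  by rewrite merge_sum_left // E -!mulrA (pt_path_com_head vC vS aC xC).
have free_right y v' : y \notin S -> (if u is x :: _ then x \in M else true) ->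
    v = y :: v' -> merge_sum S M k.+1 u v a b =
      pt_path a u b * pt_path a v b * plucker_path a com b.
  move=> yS uM Ev; have H' := merge_data_sym H; rewrite Ev in H' *.
  rewrite merge_sum_sym [pt_path a u b * _]mulrC (free_left M S) //.
  have H2 := merge_data_left yS H'.
  by rewrite merge_sum_sym (IHk _ _ com) ?[pt_path y u b * _]mulrC //;
    apply: merge_data_sym.
case Eu: u => [|x u'] in free_right H *; case Ev: v => [|y v'] in free_right H *.
- by case: H => _ [<- _] _ _ [_].
- have [yS|yS] := boolP (y \in S); last exact: (free_right y v').
  by case: H => _ [<- /=]; rewrite yS.
- have [xM|xM] := boolP (x \in M); first by case: H => _ [/= uC vC]; rewrite xM -vC in uC.
  by apply: free_left => //; apply: IHk; apply: merge_data_left H.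
have [xM|xM] := boolP (x \in M); have [yS|yS] := boolP (y \in S).
- have [[/= /andP[xS uS] /andP[_ vM]] [/= uC +]] := H; rewrite yS -uC xM.
  case=> -> vC [ua va] [bu bv] [ax kE].
  rewrite merge_sum_both // (IHk _ _ [seq z <- u' | z \in M]).
    by rewrite /=; field; rewrite P_neq0.
  move: bu; rewrite inE negb_or => /andP[bx bu'].
  move: bv; rewrite inE negb_or => /andP[_ bv'].
  move: ua va => /= /and3P[_ xu uu'] /andP[_ /andP[xv uv]].
  split; split=> //; [by rewrite /= xu | by rewrite /= xv | | ].
    case E: [seq _ <- _ | _] => [|z s] /=; first by rewrite eq_sym.
    have: z \in [seq z <- u' | z \in M] by rewrite E inE eqxx.
    by rewrite mem_filter => /andP[_ zu]; apply: contraNneq xu => ->.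
  by move: kE; rewrite /= addnS !addSn addnS => -[].
- exact: (free_right y v').
- by apply: free_left => //; apply: IHk; apply: merge_data_left H.
(* Both heads are free: the merges starting with [x] and those starting with [y] add up by partial
   fractions, with [d] the next common letter or [b]. *)
have H1 := merge_data_left xM H.
have H2 := merge_data_sym (merge_data_left yS (merge_data_sym H)).
have [[/= /andP[xS _] /andP[yM _]] _ [/= ua va] _ _] := H.
rewrite merge_sum_two // (IHk _ _ _ _ H1) (IHk _ _ _ _ H2) /=.
have xy : x != y by apply: contraNneq yS => <-.
have [ax ay] : a != x /\ a != y.
  by move: ua va; rewrite !inE !negb_or => /andP[/andP[-> _] _] /andP[/andP[-> _] _].
have [_ _ _ _ [xC _]] := H1; have [_ _ _ _ [yC _]] := H2; have [_ _ _ _ [aC _]] := H.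
rewrite (plucker_path_head a xC) (plucker_path_head y xC).
have := plucker_partial_fractions (head b com) ax ay xy.
have := P_neq0 xC; move: (plucker_path _ _ _) (pt_path _ _ _) (pt_path _ _ _).
move: (head b com) => d pl p1 p2 Nxd E.
transitivity (((P a x)^-1 * ((P x y)^-1 * P x d) + (P a y)^-1 * ((P y x)^-1 * P y d))
  * (p1 * p2 * pl / P x d)); last by rewrite E; ring.
have yx : P y x != 0 by rewrite P_neq0 // eq_sym.
by field; rewrite ?Nxd ?yx ?P_neq0.
Qed.

(** * Sums over all arrangements of a set of letters *)

Lemma perm_filter_enum (S T : {set X}) w : S \subset T -> perm_eq w (enum T) ->
  perm_eq [seq x <- w | x \in S] (enum S).
Proof.
move=> sST wT; have uw : uniq w by rewrite (perm_uniq wT) enum_uniq.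
apply: uniq_perm; rewrite ?enum_uniq ?(filter_uniq _ uw) // => x.
rewrite mem_filter (perm_mem wT) !mem_enum.
by case: (boolP (x \in S)) => // /(subsetP sST).
Qed.

Lemma size_perm_enum (S : {set X}) w : perm_eq w (enum S) -> size w = #|S|.
Proof. by move/perm_size; rewrite cardE. Qed.

Definition word_sum (S : {set X}) (f : seq X -> F) : F :=
  \sum_(w : #|S|.-tuple X | perm_eq w (enum S)) f w.

(** A merge contains every letter of the union and has exactly that many places, hence no
    repetition. *)
Lemma is_merge_perm S M u v w :
    perm_eq u (enum S) -> perm_eq v (enum M) -> size w = #|S :|: M| ->
  is_merge S M u v w -> perm_eq w (enum (S :|: M)).
Proof.
move=> uS vM sw /and3P[/allP wT /eqP wu /eqP wv].
have sub : {subset enum (S :|: M) <= w}.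
  move=> x; rewrite mem_enum inE.
  have filt (Q : pred X) : x \in [seq y <- w | Q y] -> x \in w.
    by rewrite mem_filter => /andP[].
  case/orP; rewrite -mem_enum -?(perm_mem uS) -?(perm_mem vM) -?wu -?wv.
    exact: filt.
  exact: filt.
have uw : uniq w.
  by apply: (leq_size_uniq _ sub); rewrite ?enum_uniq // sw cardE.
apply: uniq_perm; rewrite ?enum_uniq // => x; apply/idP/idP; last exact: sub.
by rewrite mem_enum; apply: wT.
Qed.

(** Each arrangement of the union is a merge of exactly one pair, its two restrictions. Grouping by
    pairs, the merge formula with [com = [:: c]] and both ends at [a] yields the factor
    [P a c * P c a]. *)
Lemma word_sum_glue S M a c (f g : seq X -> F) :
    a \notin S :|: M -> S :&: M = [set c] ->
  word_sum (S :|: M) (fun w => f [seq x <- w | x \in S] *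
    g [seq x <- w | x \in M] * pt_path a w a) =
  P a c * P c a * word_sum S (fun u => f u * pt_path a u a) *
  word_sum M (fun v => g v * pt_path a v a).
Proof.
move=> aSM SMc; rewrite /word_sum -mulrA big_distrlr /= big_distrr /=.
under [RHS]eq_bigr => u _ do rewrite big_distrr /=.
rewrite pair_big /=.
transitivity (\sum_(q : #|S|.-tuple X * #|M|.-tuple X |
     perm_eq q.1 (enum S) && perm_eq q.2 (enum M))
   \sum_(w : #|S :|: M|.-tuple X | is_merge S M q.1 q.2 w)
   f q.1 * g q.2 * pt_path a w a); last first.
  apply: eq_bigr => -[u v] /= /andP[uS vM].
  rewrite -big_distrr /= -/(merge_sum S M _ u v a a).
  have cSM : c \in S :&: M by rewrite SMc inE.
  rewrite (@merge_sumE _ _ _ _ _ [:: c]); first by rewrite /=; ring.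
  have memS x : (x \in val u) = (x \in S) by rewrite (perm_mem uS) mem_enum.
  have memM x : (x \in val v) = (x \in M) by rewrite (perm_mem vM) mem_enum.
  move: aSM; rewrite inE negb_or => /andP[aS aM].
  split; split; rewrite /= ?memS ?memM //.
  - by apply/allP => x; rewrite memS.
  - by apply/allP => x; rewrite memM.
  - apply: perm_small_eq => //; rewrite -(enum_set1 c) -SMc.
    rewrite (eq_in_filter (a2 := mem (S :&: M))).
      by apply: perm_filter_enum uS; apply: subsetIl.
    by move=> x; rewrite memS /= inE => ->.
  - apply: perm_small_eq => //; rewrite -(enum_set1 c) -SMc.
    rewrite (eq_in_filter (a2 := mem (S :&: M))).
      by apply: perm_filter_enum vM; apply: subsetIr.
    by move=> x; rewrite memM /= inE andbC => ->.
  - by rewrite aS (perm_uniq uS) enum_uniq.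
  - by rewrite aM (perm_uniq vM) enum_uniq.
  - by apply: contraNneq aS => ->; move: cSM; rewrite inE => /andP[].
  - by rewrite !size_tuple -(cards1 c) -SMc cardsUI.
rewrite (exchange_big_dep (fun w : #|S :|: M|.-tuple X =>
  perm_eq w (enum (S :|: M)))) /=; last first.
  by move=> [u v] w /= /andP[uS vM]; apply: is_merge_perm; rewrite ?size_tuple.
apply: eq_bigr => w wT.
have wS := perm_filter_enum (subsetUl S M) wT.
have wM := perm_filter_enum (subsetUr S M) wT.
have sS : size [seq x <- w | x \in S] == #|S| by rewrite (size_perm_enum wS).
have sM : size [seq x <- w | x \in M] == #|M| by rewrite (size_perm_enum wM).
rewrite (big_pred1 (Tuple sS, Tuple sM)) // => -[u v] /=.
rewrite /is_merge xpair_eqE -!val_eqE /=.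
have -> : all (mem (S :|: M)) w.
  by apply/allP => x; rewrite (perm_mem wT) mem_enum.
rewrite /= [val u == _]eq_sym [val v == _]eq_sym.
case: eqP => [<-|_]; case: eqP => [<-|_]; rewrite ?andbF //.
by rewrite wS wM.
Qed.

Lemma word_sum_rot1 S (f : seq X -> F) :
  word_sum S (fun w => f (rot 1 w)) = word_sum S f.
Proof.
rewrite /word_sum [RHS](reindex (fun w : #|S|.-tuple X => [tuple of rot 1 w])) /=.
  by apply: eq_bigl => w; rewrite perm_rot.
exists (fun w : #|S|.-tuple X => [tuple of rotr 1 w]) => w _; apply: val_inj => /=.
  exact: rotK.
exact: rotrK.
Qed.

(* Placing [a] anywhere in a fixed cyclic word: the partial fractions
   P x y / (P a x * P a y) telescope around the cycle. *)
Lemma word_sum_rotation_invariant S a b (f : seq X -> F) :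
    a \notin S -> b \in S -> (1 < #|S|)%N -> (forall w, f (rot 1 w) = f w) ->
  word_sum S (fun w => f w * pt_path a w a) = 0.
Proof.
move=> aS bS S2 frot.
(* The Parke-Taylor factor of the cyclic word [w] without [a]; the value [0] concerns only the empty
   word, which [S2] excludes. *)
pose cyc w := if w is x :: w' then pt_path x w' x else 0.
have cyc_rot w : cyc (rot 1 w) = cyc w.
  by case: w => [|x [|y w]] //; rewrite /rot /= cats1 pt_path_rcons mulrC.
(* With [b] as reference letter, the Plücker relation gives [h x - h z = P a b * P z x / (P a x * P
   a z)]: inserting [a] between the last letter [z] and the first letter [x] is a difference of
   values of [h]. *)
pose h x := P b x / P a x.
pose G w := f w * cyc w * h (last b w) / P a b.
have E w : perm_eq w (enum S) -> f w * pt_path a w a = G w - G (rot 1 w).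
  move=> wS; rewrite /G frot cyc_rot.
  have memS x : x \in w -> a != x.
    by rewrite (perm_mem wS) mem_enum; apply: contraTneq => <-.
  have ab : P a b != 0 by rewrite P_neq0 //; apply: contraNneq aS => ->.
  have uw : uniq w by rewrite (perm_uniq wS) enum_uniq.
  move: S2; rewrite -(size_perm_enum wS).
  case: w {wS} memS uw => [|x w] //; case/lastP: w => [|w z] // memS uw _.
  rewrite /rot /= drop0 take0 last_cat /= last_rcons !pt_path_rcons /h.
  have xz : z != x.
    by apply: contraTneq uw => ->; rewrite /= mem_rcons inE eqxx.
  have Nax : P a x != 0 by rewrite P_neq0 // memS // inE eqxx.
  have Naz : P a z != 0.
    by rewrite P_neq0 // memS // inE mem_rcons inE eqxx orbT.
  have -> : (P z x)^-1 = P a b / (P a z * P b x - P a x * P b z).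
    by rewrite -P_plucker invfM mulVKf.
  have D0 : P a z * P b x - P a x * P b z != 0.
    by rewrite -P_plucker mulf_neq0 // P_neq0.
  by rewrite (P_anti a z); field; rewrite D0 ab Nax Naz oppr_eq0 Naz.
rewrite /word_sum (eq_bigr _ (fun w : #|S|.-tuple X => @E w)) sumrB.
by have := word_sum_rot1 S G; rewrite /word_sum => ->; rewrite subrr.
Qed.

(** Gluing at [b] and then at [c] makes the sum over [S2] a factor, which telescopes to zero because
    [f2] depends only on the cyclic word. *)
Lemma word_sum_triangle0 (S1 S2 S3 : {set X}) a b c (f1 f2 f3 : seq X -> F) :
    a \notin S1 :|: (S3 :|: S2) -> S1 :&: (S3 :|: S2) = [set b] ->
    S3 :&: S2 = [set c] -> b \in S2 -> b != c ->
    (forall w, f2 (rot 1 w) = f2 w) ->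
  word_sum (S1 :|: (S3 :|: S2)) (fun w => f1 [seq x <- w | x \in S1] *
    (f3 [seq x <- w | x \in S3] * f2 [seq x <- w | x \in S2]) * pt_path a w a) = 0.
Proof.
move=> aS S1b S3c bS2 bc f2rot.
have aS2 : a \notin S2 by move: aS; rewrite !inE !negb_or => /and3P[].
have cS2 : c \in S2 by have := set11 c; rewrite -S3c inE => /andP[].
have filt (S' S'' : {set X}) w : S' \subset S'' ->
    [seq x <- [seq x <- w | x \in S''] | x \in S'] = [seq x <- w | x \in S'].
  move=> sS; rewrite -filter_predI; apply: eq_filter => x /=.
  by case: (boolP (x \in S')) => //= /(subsetP sS).
pose g v := f3 [seq x <- v | x \in S3] * f2 [seq x <- v | x \in S2].
rewrite [LHS](_ : _ = word_sum (S1 :|: (S3 :|: S2)) (fun w =>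
  f1 [seq x <- w | x \in S1] * g [seq x <- w | x \in S3 :|: S2] *
  pt_path a w a)); last first.
  by apply: eq_bigr => w _; rewrite /g !filt ?subsetUl ?subsetUr.
have aS3 : a \notin S3 :|: S2 by move: aS; rewrite inE negb_or => /andP[].
rewrite (word_sum_glue _ _ aS S1b) {}/g (word_sum_glue _ _ aS3 S3c).
rewrite [word_sum S2 _](@word_sum_rotation_invariant _ _ b) ?mulr0 //.
rewrite (cardsD1 b) bS2 (cardsD1 c) !inE eq_sym bc cS2.
by [].
Qed.

End ParkeTaylorWords.

(** * Polygons with disjoint interiors *)

Section Geometry.
Variable R : realFieldType.
Local Notation plane := 'rV[R]_2.
Implicit Types (P Q S y z : plane).

Lemma signed_area_rot P Q S : signed_area P Q S = signed_area Q S P.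
Proof. by rewrite /signed_area; ring. Qed.

Lemma signed_area_swap P Q S : signed_area P S Q = - signed_area P Q S.
Proof. by rewrite /signed_area; ring. Qed.

Lemma small_perturbation (u v : R) : u < 0 ->
  exists2 e : R, 0 < e & forall t, 0 < t <= e -> u + t * v < 0.
Proof.
move=> u0; have v1 : 0 < `|v| + 1 by rewrite ltr_wpDl.
(* This bound forces [t * |v| <= - u / 2]; the added [1] keeps the denominator positive. *)
exists (- u / (2 * (`|v| + 1))) => [|t /andP[t0]].
  by rewrite divr_gt0 ?oppr_gt0 // mulr_gt0.
rewrite ler_pdivlMr ?mulr_gt0 // => tu.
have : t * v <= t * `|v| by rewrite ler_pM2l // ler_norm.
by lra.
Qed.

Lemma affine_pos_nbhs (y : plane) (u al be : R) : 0 < u ->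
  exists2 e : R, 0 < e & forall z, (forall k, `|z 0 k - y 0 k| < e) ->
    0 <= u + al * (z 0 0 - y 0 0) + be * (z 0 1 - y 0 1).
Proof.
move=> u0; have s0 : 0 < `|al| + `|be| + 1 by rewrite ltr_wpDl // addr_ge0.
exists (u / (`|al| + `|be| + 1)) => [|z zy]; first by rewrite divr_gt0.
set e := u / _ in zy.
have ue : u = e * (`|al| + `|be| + 1) by rewrite divfK // gt_eqF.
have bnd (ga : R) k : - (`|ga| * e) <= ga * (z 0 k - y 0 k).
  have := ler_norm (- (ga * (z 0 k - y 0 k))); rewrite normrN normrM => h.
  have := ler_wpM2l (normr_ge0 ga) (ltW (zy k)); lra.
have e0 : 0 < e by rewrite divr_gt0.
by have := bnd al 0; have := bnd be 1; rewrite {1}ue; lra.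
Qed.

Lemma sum_delta (n : nat) (V : lmodType R) (A : {set 'I_n}) (i : 'I_n) (t : R)
    (f : 'I_n -> V) : i \in A ->
  \sum_(k in A) (t * (k == i)%:R) *: f k = t *: f i.
Proof.
move=> iA; rewrite (bigD1 i) //= eqxx mulr1 big1 ?addr0 // => k /andP[_ /negbTE->].
by rewrite mulr0 scale0r.
Qed.

(** The three quotients are the barycentric coordinates of [y], for either orientation of the
    triangle. Being affine, they stay nonnegative on a small square around [y]. *)
Lemma triangle_region_interior (n : nat) (p : 'I_n -> plane) (A : {set 'I_n})
    (i j k : 'I_n) y : i \in A -> j \in A -> k \in A ->
    0 < signed_area y (p j) (p k) / signed_area (p i) (p j) (p k) ->
    0 < signed_area (p i) y (p k) / signed_area (p i) (p j) (p k) ->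
    0 < signed_area (p i) (p j) y / signed_area (p i) (p j) (p k) ->
  region_interior p A y.
Proof.
move=> iA jA kA; set D := signed_area (p i) (p j) (p k) => y1 y2 y3.
have D0 : D != 0 by apply: contraTneq y1 => ->; rewrite invr0 mulr0 ltxx.
have [e1 e10 h1] := affine_pos_nbhs y ((p j 0 1 - p k 0 1) / D)
  ((p k 0 0 - p j 0 0) / D) y1.
have [e2 e20 h2] := affine_pos_nbhs y ((p k 0 1 - p i 0 1) / D)
  ((p i 0 0 - p k 0 0) / D) y2.
have [e3 e30 h3] := affine_pos_nbhs y ((p i 0 1 - p j 0 1) / D)
  ((p j 0 0 - p i 0 0) / D) y3.
exists (Num.min e1 (Num.min e2 e3)); first by rewrite !lt_min e10 e20.
move=> z zy; pose l1 := signed_area z (p j) (p k) / D.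
pose l2 := signed_area (p i) z (p k) / D; pose l3 := signed_area (p i) (p j) z / D.
have l1_ge0 : 0 <= l1.
  have /h1 : forall m, `|z 0 m - y 0 m| < e1.
    by move=> m; have := zy m; rewrite !lt_min => /andP[].
  by congr (_ <= _); rewrite /l1 /signed_area; field.
have l2_ge0 : 0 <= l2.
  have /h2 : forall m, `|z 0 m - y 0 m| < e2.
    by move=> m; have := zy m; rewrite !lt_min => /and3P[].
  by congr (_ <= _); rewrite /l2 /signed_area; field.
have l3_ge0 : 0 <= l3.
  have /h3 : forall m, `|z 0 m - y 0 m| < e3.
    by move=> m; have := zy m; rewrite !lt_min => /and3P[].
  by congr (_ <= _); rewrite /l3 /signed_area; field.
have ord2 (m : 'I_2) : m = 0 \/ m = 1.
  by case: m => -[|[|//]] ?; [left | right]; apply: val_inj.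
exists (fun m => l1 * (m == i)%:R + l2 * (m == j)%:R + l3 * (m == k)%:R); split.
- by move=> m _; rewrite !addr_ge0 //; apply: mulr_ge0; rewrite ?ler0n.
- have delta1 m t : m \in A -> \sum_(q in A) t * (q == m)%:R = t.
    move=> mA; rewrite (bigD1 m) //= eqxx mulr1 big1 ?addr0 // => q.
    by case/andP=> _ /negbTE->; rewrite mulr0.
  rewrite !big_split /= !delta1 // /l1 /l2 /l3 -!mulrDl.
  by apply: (canLR (mulfK D0)); rewrite /D /signed_area; ring.
under eq_bigr => m _ do rewrite 2!scalerDl.
rewrite !big_split /= !sum_delta //; apply/rowP=> m; rewrite !mxE.
apply: (mulfI D0).
transitivity ((l1 * D) * p i 0 m + (l2 * D) * p j 0 m + (l3 * D) * p k 0 m); last by ring.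
rewrite /l1 /l2 /l3 !divfK //.
by rewrite /D /signed_area; case: (ord2 m) => ->; ring.
Qed.

(* The weights start at the point where the chord [d e] meets the line where the
   first functional vanishes; it is pushed towards [e], then slightly towards [f]. *)
Lemma exists_crossing_weights (d1 e1 f1 d2 e2 f2 d3 e3 f3 : R) :
    0 < d1 -> e1 < 0 -> d1 * e2 - e1 * d2 < 0 -> d1 * e3 - e1 * d3 < 0 ->
  exists al be ga : R, [/\ [/\ 0 < al, 0 < be & 0 < ga],
    al * d1 + be * e1 + ga * f1 < 0,
    al * d2 + be * e2 + ga * f2 < 0
  & al * d3 + be * e3 + ga * f3 < 0].
Proof.
move=> d10 e10 h2 h3.
(* [nu] is the share of [f] in the push, small enough that moving towards [e] and [f] together still
   lowers the first functional. *)
have [nu nu0 hnu] := small_perturbation f1 e10.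
have {hnu}hnu : e1 + nu * f1 < 0 by apply: hnu; rewrite nu0 lexx.
have [t2 t20 H2] := small_perturbation (e2 + nu * f2) h2.
have [t3 t30 H3] := small_perturbation (e3 + nu * f3) h3.
pose t := Num.min t2 t3; have t0 : 0 < t by rewrite lt_min t20.
have {}H2 := H2 t; have {}H3 := H3 t.
rewrite t0 ge_min lexx /= in H2; rewrite t0 ge_min lexx orbT in H3.
exists (- e1), (d1 + t), (t * nu); split.
- by rewrite oppr_gt0 e10 addr_gt0 // mulr_gt0.
- have : t * (e1 + nu * f1) < 0 by rewrite pmulr_rlt0.
  by lra.
- by have := H2 isT; lra.
- by have := H3 isT; lra.
Qed.

(** The chord [d e] crosses the segment [a b], with [e] on the side of [c]. The functionals are the
    signed areas against the sides of [a b c]; a suitable point near the crossing is inside both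
    triangles. *)
Lemma exists_crossing_point (a b c d e f : plane) :
    signed_area a b c < 0 -> signed_area a d b < 0 -> signed_area a b e < 0 ->
    signed_area b e d < 0 -> signed_area a d e < 0 -> signed_area d e f != 0 ->
  exists y, [/\ 0 < signed_area y b c / signed_area a b c,
                0 < signed_area a y c / signed_area a b c
              & 0 < signed_area a b y / signed_area a b c] /\
            [/\ 0 < signed_area y e f / signed_area d e f,
                0 < signed_area d y f / signed_area d e f
              & 0 < signed_area d e y / signed_area d e f].
Proof.
move=> abc adb abe bed ade Ndef.
have abd : 0 < signed_area a b d by rewrite signed_area_swap oppr_gt0.
(* The left side equals [- signed_area a b c * signed_area b e d]: the crossing point is on the
   inner side of [b c]. Likewise for [c a] in the next claim. *)
have m2 : signed_area a b d * signed_area e b c -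
    signed_area a b e * signed_area d b c < 0.
  have : 0 < signed_area a b c * signed_area b e d by rewrite nmulr_rgt0.
  by rewrite /signed_area; lra.
have m3 : signed_area a b d * signed_area a e c -
    signed_area a b e * signed_area a d c < 0.
  have : 0 < signed_area a b c * signed_area a d e by rewrite nmulr_rgt0.
  by rewrite /signed_area; lra.
have [al [be [ga [[al0 be0 ga0] h1 h2 h3]]]] := exists_crossing_weights
  (signed_area a b f) (signed_area f b c) (signed_area a f c) abd abe m2 m3.
pose s := al + be + ga; have s0 : 0 < s by rewrite !addr_gt0.
have Ns : s != 0 by rewrite gt_eqF.
pose y : plane := s^-1 *: (al *: d + be *: e + ga *: f).
have yE k : y 0 k = s^-1 * (al * d 0 k + be * e 0 k + ga * f 0 k) by rewrite !mxE.
exists y; split; split.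
- rewrite nmulr_lgt0 ?invr_lt0 //.
  have -> : signed_area y b c = s^-1 * (al * signed_area d b c +
     be * signed_area e b c + ga * signed_area f b c).
    by rewrite /signed_area !yE /s; field.
  by rewrite pmulr_rlt0 ?invr_gt0.
- rewrite nmulr_lgt0 ?invr_lt0 //.
  have -> : signed_area a y c = s^-1 * (al * signed_area a d c +
     be * signed_area a e c + ga * signed_area a f c).
    by rewrite /signed_area !yE /s; field.
  by rewrite pmulr_rlt0 ?invr_gt0.
- rewrite nmulr_lgt0 ?invr_lt0 //.
  have -> : signed_area a b y = s^-1 * (al * signed_area a b d +
     be * signed_area a b e + ga * signed_area a b f).
    by rewrite /signed_area !yE /s; field.
  by rewrite pmulr_rlt0 ?invr_gt0.
- have -> : signed_area y e f = al / s * signed_area d e f.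
    by rewrite /signed_area !yE /s; field.
  by rewrite mulfK // divr_gt0.
- have -> : signed_area d y f = be / s * signed_area d e f.
    by rewrite /signed_area !yE /s; field.
  by rewrite mulfK // divr_gt0.
- have -> : signed_area d e y = ga / s * signed_area d e f.
    by rewrite /signed_area !yE /s; field.
  by rewrite mulfK // divr_gt0.
Qed.

(** * Polygons and the arcs cut off by three vertices *)

Variable n : nat.
Implicit Types (p : 'I_n -> plane) (A B : {set 'I_n}) (a b c d e : 'I_n).

Lemma clockwise_signed_area p i j k : clockwise_convex_polygon p ->
  clockwise i j k -> signed_area (p i) (p j) (p k) < 0.
Proof.
case=> _ hp; rewrite /clockwise => /or3P[] /andP[h1 h2]; first exact: hp.
  by rewrite signed_area_rot; apply: hp.
by rewrite -signed_area_rot; apply: hp.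
Qed.

Lemma signed_area_neq0 p i j k : clockwise_convex_polygon p ->
  i != j -> i != k -> j != k -> signed_area (p i) (p j) (p k) != 0.
Proof.
move=> hp; rewrite -!val_eqE /= => ij ik jk.
have [h|h] : clockwise i j k \/ clockwise i k j by rewrite /clockwise; lia.
  by rewrite lt_eqF // clockwise_signed_area.
by rewrite signed_area_swap oppr_eq0 lt_eqF // clockwise_signed_area.
Qed.

Definition in_arc a b (x : 'I_n) : bool := [|| x == a, x == b | clockwise a x b].

(** The vertices [a], [d], [b], [e] are in clockwise order, so the chords [a b] and [d e] cross; a
    third vertex [f] of [B] completes the second triangle. *)
Lemma crossing_chord_interiors p A B a b c d e :
    clockwise_convex_polygon p -> (2 < #|B|)%N ->
    a \in A -> b \in A -> c \in A -> clockwise a b c ->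
    d \in B -> e \in B -> clockwise a d b -> ~~ in_arc a b e ->
  exists y, region_interior p A y /\ region_interior p B y.
Proof.
move=> hp B3 aA bA cA abc dB eB adb; rewrite /in_arc -!val_eqE /= => eab.
have [f fB /norP[fd fe]] : exists2 f, f \in B & ~~ ((f == d) || (f == e)).
  have : ~~ (B \subset [set d; e]).
    apply: contraTN B3 => /subset_leq_card; rewrite -leqNgt => /leq_trans; apply.
    by rewrite cards2; case: (_ != _).
  by case/subsetPn=> f fB; rewrite !inE; exists f.
have de : d != e by apply/eqP => de; move: eab; rewrite -de adb !orbT.
have [y [[y1 y2 y3] [z1 z2 z3]]] : exists y,
    [/\ 0 < signed_area y (p b) (p c) / signed_area (p a) (p b) (p c),
        0 < signed_area (p a) y (p c) / signed_area (p a) (p b) (p c)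
      & 0 < signed_area (p a) (p b) y / signed_area (p a) (p b) (p c)] /\
    [/\ 0 < signed_area y (p e) (p f) / signed_area (p d) (p e) (p f),
        0 < signed_area (p d) y (p f) / signed_area (p d) (p e) (p f)
      & 0 < signed_area (p d) (p e) y / signed_area (p d) (p e) (p f)].
  apply: exists_crossing_point; try by [apply: clockwise_signed_area].
  - by apply: clockwise_signed_area => //; move: eab adb abc; rewrite /clockwise; lia.
  - by apply: clockwise_signed_area => //; move: eab adb abc; rewrite /clockwise; lia.
  - by apply: clockwise_signed_area => //; move: eab adb abc; rewrite /clockwise; lia.
  - by apply: signed_area_neq0; rewrite // eq_sym.
exists y; split; [apply: (triangle_region_interior aA bA cA) |
  apply: (triangle_region_interior dB eB fB)] => //.
Qed.

Lemma centroid_interior p A a b c : clockwise_convex_polygon p ->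
    a \in A -> b \in A -> c \in A -> clockwise a b c ->
  region_interior p A (3^-1 *: (p a + p b + p c)).
Proof.
move=> hp aA bA cA /(clockwise_signed_area hp) abc.
have N3 : 3%:R != 0 :> R by rewrite pnatr_eq0.
by apply: (triangle_region_interior aA bA cA); rewrite nmulr_lgt0 ?invr_lt0 //;
  [ have -> : signed_area (3^-1 *: (p a + p b + p c)) (p b) (p c) =
      3^-1 * signed_area (p a) (p b) (p c) by rewrite /signed_area !mxE; field
  | have -> : signed_area (p a) (3^-1 *: (p a + p b + p c)) (p c) =
      3^-1 * signed_area (p a) (p b) (p c) by rewrite /signed_area !mxE; field
  | have -> : signed_area (p a) (p b) (3^-1 *: (p a + p b + p c)) =
      3^-1 * signed_area (p a) (p b) (p c) by rewrite /signed_area !mxE; field ];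
  rewrite pmulr_rlt0 // invr_gt0 ltr0n.
Qed.

Lemma polygon_in_arc p (T : {set {set 'I_n}}) A B a b c :
    clockwise_convex_polygon p -> is_polygon_partition p T ->
    A \in T -> B \in T -> A != B ->
    a \in A -> b \in A -> c \in A -> clockwise a b c ->
  [\/ {in B, forall x, in_arc a b x}, {in B, forall x, in_arc b c x}
    | {in B, forall x, in_arc c a x}].
Proof.
move=> hp [T3 _ Tdisj] AT BT AB aA bA cA abc; have disj := Tdisj A B AT BT AB.
have B3 := T3 B BT.
(* A vertex of [B] strictly inside the arc and another one outside it would span a crossing
   chord. *)
have side a' b' c' : a' \in A -> b' \in A -> c' \in A -> clockwise a' b' c' ->
    {in B, forall x, in_arc a' b' x} \/ forall d, d \in B -> ~~ clockwise a' d b'.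
  move=> aA' bA' cA' abc'.
  case: (pickP [pred d in B | clockwise a' d b']) => /= [d /andP[dB adb]|none].
    left=> e eB; apply/negPn/negP => ne.
    have [y /disj[]] := crossing_chord_interiors hp B3 aA' bA' cA' abc' dB eB adb ne.
  by right=> d dB; have := none d; rewrite /= dB /= => ->.
have rotcw (i j k : 'I_n) : clockwise i j k -> clockwise j k i by rewrite /clockwise; lia.
have [?|ab] := side a b c aA bA cA abc; first exact: Or31.
have [?|bc] := side b c a bA cA aA (rotcw _ _ _ abc); first exact: Or32.
have [?|ca] := side c a b cA aA bA (rotcw _ _ _ (rotcw _ _ _ abc)); first exact: Or33.
(* No vertex of [B] is strictly inside an arc, so [B] is the triangle [a b c], and its centroid is
   interior to both polygons. *)
have sB : B \subset [set a; b; c].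
  apply/subsetP=> x xB; move: (ab x xB) (bc x xB) (ca x xB) abc.
  by rewrite !inE -!val_eqE /clockwise /=; lia.
have abcB : B = [set a; b; c].
  apply/eqP; rewrite eqEcard sB; apply: leq_trans B3.
  rewrite (leq_trans (leq_card_setU _ _)) // cards1 cards2 addn1.
  by case: (_ != _).
case: (disj (3^-1 *: (p a + p b + p c))); split; apply: centroid_interior => //;
  by rewrite abcB !inE eqxx ?orbT.
Qed.

End Geometry.

(** * Cyclic orders as words *)

Section Chains.
Variable X : finType.
Implicit Types (s w : seq X) (x y z a : X).

Lemma subseq_iota3 i j k m :
  subseq [:: i; j; k] (iota 0 m) = [&& (i < j)%N, (j < k)%N & (k < m)%N].
Proof.
apply/idP/and3P=> [sub|[ij jk km]].
  have /= := subseq_sorted ltn_trans sub (iota_ltn_sorted 0 m).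
  rewrite andbT => /andP[-> ->]; split=> //.
  by have := mem_subseq sub (x := k); rewrite !inE eqxx !orbT mem_iota => /(_ isT).
rewrite (_ : [:: i; j; k] = [seq l <- iota 0 m | l \in [:: i; j; k]]).
  exact: filter_subseq.
apply: (irr_sorted_eq ltn_trans ltnn); first by rewrite /= ij jk.
  exact: sorted_filter ltn_trans _ _ (iota_ltn_sorted 0 m).
move=> l; rewrite mem_filter mem_iota !inE.
by case: eqP => [->|_]; [lia | case: eqP => [->|_]; [lia | case: eqP => [->|//]; lia]].
Qed.

Lemma subseq3P x y z s :
  reflect (exists i j k : 'I_(size s), [/\ (i < j)%N, (j < k)%N &
     (x, y, z) = (tnth (in_tuple s) i, tnth (in_tuple s) j, tnth (in_tuple s) k)])
   (subseq [:: x; y; z] s).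
Proof.
apply: (iffP idP) => [/subseqP[m sm mE]|[i [j [k [ij jk [-> -> ->]]]]]]; last first.
  rewrite !(tnth_nth x) /=.
  rewrite -[s in subseq _ s](mkseq_nth x).
  apply: (map_subseq (nth x s) (s1 := [:: val i; val j; val k])).
  by rewrite subseq_iota3 ij jk ltn_ord.
rewrite -(mkseq_nth x s) /mkseq -map_mask in mE.
have := mask_subseq m (iota 0 (size s)); move: mE.
case: (mask _ _) => [|i [|j [|k [|? ?]]]] //= [xi yj zk].
rewrite (subseq_iota3 i j k) => /and3P[ij jk ks].
have js := ltn_trans jk ks; have is_ := ltn_trans ij js.
exists (Ordinal is_), (Ordinal js), (Ordinal ks); split=> //.
by rewrite !(tnth_nth x) /= -xi -yj -zk.
Qed.

(** Subsequences replace indices here because they behave well when a word is filtered. *)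
Lemma mem_chain s x y z : ((x, y, z) \in chain s) =
  [|| subseq [:: x; y; z] s, subseq [:: y; z; x] s | subseq [:: z; x; y] s].
Proof.
rewrite inE; apply/idP/idP.
  case/existsP=> i /existsP[j /existsP[k]].
  case/and3P=> ij jk; rewrite !inE => /or3P[] /eqP[-> -> ->].
  - by apply/or3P/Or31/subseq3P; exists i, j, k.
  - by apply/or3P/Or33/subseq3P; exists i, j, k.
  - by apply/or3P/Or32/subseq3P; exists i, j, k.
by case/or3P=> /subseq3P[i [j [k [ij jk [-> -> ->]]]]];
  apply/existsP; exists i; apply/existsP; exists j; apply/existsP; exists k;
  rewrite ij jk !inE eqxx ?orbT.
Qed.

Lemma chain_filter (Q : pred X) s x y z :
  ((x, y, z) \in chain [seq t <- s | Q t]) =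
  [&& Q x, Q y, Q z & (x, y, z) \in chain s].
Proof.
rewrite !mem_chain !subseq_filter /=.
by case: (Q x); case: (Q y); case: (Q z); rewrite ?andbF.
Qed.

Lemma mem_chain_all s x y z :
  (x, y, z) \in chain s -> [/\ x \in s, y \in s & z \in s].
Proof.
rewrite mem_chain.
by case/or3P=> /mem_subseq sub; split; apply: sub; rewrite !inE eqxx ?orbT.
Qed.

Lemma chain_rot1 s : chain (rot 1 s) = chain s.
Proof.
case: s => [|h s]; first by [].
rewrite /rot /= drop0 take0 cats1.
have sub_rcons t u : subseq (rcons t u) (rcons s h) =
    subseq (rcons t u) s || (u == h) && subseq t s.
  rewrite -subseq_rev !rev_rcons /= -(subseq_rev t s) -(subseq_rev (rcons t u)).
  rewrite rev_rcons; case: eqP => //= _; last by rewrite orbF.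
  by case E: (subseq (_ :: _) _); rewrite // (cons_subseq E).
have sub_cons t u : subseq (u :: t) (h :: s) =
    subseq (u :: t) s || (u == h) && subseq t s.
  rewrite [LHS]/=; case: eqP => //= _; last by rewrite orbF.
  by case E: (subseq (u :: t) s); rewrite // (cons_subseq E).
apply/setP=> -[[x y] z]; rewrite !mem_chain.
rewrite !(sub_rcons [:: _; _]) !sub_cons.
do 3 case: (subseq [:: _; _; _] s); rewrite ?orbT //=.
by do 3 case: (_ && _).
Qed.

Lemma chain_is_total w : uniq w -> (forall x, x \in w) ->
  is_total_cyclic_order (chain w).
Proof.
move=> uw fw.
have E x y z : ((x, y, z) \in chain w) =
    [|| (index x w < index y w < index z w)%N,
        (index y w < index z w < index x w)%N
      | (index z w < index x w < index y w)%N].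
  by rewrite -(@chain_nth _ x w) ?index_mem // !nth_index.
apply/andP; split; first (apply/and3P; split).
- by apply/'forall_'forall_forallP => x y z; apply/implyP; rewrite !E; lia.
- by apply/'forall_'forall_forallP => x y z; apply/implyP; rewrite !E; lia.
- by apply/'forall_'forall_'forall_forallP => x y z t; apply/implyP; rewrite !E; lia.
apply/'forall_'forall_forallP => x y z; apply/implyP.
have I u v : (u == v) = (index u w == index v w).
  by apply/eqP/eqP => [->//|/(congr1 (nth u w))]; rewrite !nth_index.
by rewrite !E /= !inE !I; lia.
Qed.

(** The triples starting at [a] define a strict order for which both words are sorted, so they
    coincide. *)
Lemma chain_cons_inj a w w' : uniq (a :: w) -> uniq (a :: w') -> w =i w' ->
  (forall x, x \in a :: w) -> chain (a :: w) = chain (a :: w') -> w = w'.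
Proof.
move=> uw uw' ww' fw E.
have tot := chain_is_total uw fw.
case/andP: tot => /and3P[_ /'forall_'forall_forallP asy].
move=> /'forall_'forall_'forall_forallP tr _.
pose r := [rel x y | (a, x, y) \in chain (a :: w)].
have rtr : transitive r.
  by move=> y x z h1 h2; apply: (implyP (tr a x y z)); apply/andP.
have rirr : irreflexive r.
  move=> x; apply/negbTE/negP => /= h.
  move: h; rewrite -(nth_index a (fw x)) -[a in (a, _, _)](nth_index a (fw a)).
  by rewrite chain_nth ?index_mem //; lia.
have srt v : uniq (a :: v) -> chain (a :: v) = chain (a :: w) -> sorted r v.
  move=> uv Ev; rewrite sorted_pairwise //; apply/(pairwiseP a) => i j; rewrite !inE => iv jv ij.
  rewrite /r /= -Ev -[a in (a, _, _)]/(nth a (a :: v) 0).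
  rewrite -[nth a v i]/(nth a (a :: v) i.+1) -[nth a v j]/(nth a (a :: v) j.+1).
  by rewrite chain_nth //= ltnS ij.
by apply: (irr_sorted_eq rtr rirr) => //; [apply: srt | apply: srt].
Qed.

End Chains.

Lemma chain_rot (X : finType) (i : nat) (s : seq X) : chain (rot i s) = chain s.
Proof.
elim: i => [|i IHi]; first by rewrite rot0.
have [si|is_] := leqP (size s) i; first by rewrite rot_oversize // ltnW.
by rewrite (rotS is_) chain_rot1.
Qed.

(** * Plücker coordinates of the generic matrix *)

Section PluckerCoordinates.
Variables (K : fieldType) (n : nat).
Implicit Types (a b c d : 'I_n).

Lemma pluckerE a b : plucker K a b =
  generic_mx K n 0 a * generic_mx K n 1 b - generic_mx K n 0 b * generic_mx K n 1 a.
Proof.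
rewrite /plucker (expand_det_row _ 0) !big_ord_recl big_ord0 /cofactor !det_mx11.
have l0 : lift (0 : 'I_2) 0 = 1 by apply: val_inj.
have l1 : lift (1 : 'I_2) 0 = 0 by apply: val_inj.
have l00 : lift (ord0 : 'I_2) ord0 = 1 by apply: val_inj.
rewrite !mxE /= ?l00 ?l0 ?l1 /=.
by rewrite expr0 expr1; ring.
Qed.

Lemma plucker_anti a b : plucker K b a = - plucker K a b.
Proof. by rewrite !pluckerE; ring. Qed.

Lemma plucker_relation a b c d : plucker K a b * plucker K c d =
  plucker K a c * plucker K b d - plucker K a d * plucker K b c.
Proof. by rewrite !pluckerE; ring. Qed.

Lemma plucker_neq0 a b : a != b -> plucker K a b != 0.
Proof.
move=> ab; rewrite pluckerE !mxE -!tofracM -tofracB tofrac_eq0.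
(* At this matrix, whose columns [a] and [b] are the unit vectors, the minor takes the value [1]. *)
pose A : 'M[K]_(2, n) := \matrix_(i, j) (j == if i == 0 then a else b)%:R.
apply/eqP => /(congr1 (meval (fun i => mxvec A 0 i))).
rewrite mevalB !mevalM !mevalXU !mxvecE !mxE /= !eqxx meval0.
by rewrite eq_sym (negbTE ab) mulr1 mulr0 subr0 => /eqP; rewrite oner_eq0.
Qed.

End PluckerCoordinates.

Lemma plucker_path_prod (F : fieldType) (X : finType) (P : X -> X -> F) a w b :
  \prod_(i < (size w).+1) P (nth b (a :: w) i) (nth b w i) = plucker_path P a w b.
Proof.
elim: w a => [|x w IHw] a; first by rewrite big_ord_recl big_ord0 mulr1.
by rewrite big_ord_recl /= -IHw.
Qed.

Lemma prod_cyclic_tuple (F : fieldType) (X : finType) (P : X -> X -> F) n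
    (t : n.-tuple X) a w : val t = a :: w ->
  \prod_(i < n) P (tnth t i) (tnth t (ordS i)) = plucker_path P a w a.
Proof.
move=> tE; have nE : n = (size w).+1 by rewrite -(size_tuple t) tE.
subst n; rewrite -plucker_path_prod; apply: eq_bigr => i _.
rewrite !(tnth_nth a) tE /=; congr P.
(* At the last letter [ordS] wraps round to [a], which is also the default of [nth] past the end of
   [w]. *)
have [im|im] := ltnP i.+1 (size w).+1; first by rewrite modn_small.
have -> : i.+1 = (size w).+1 by apply/eqP; rewrite eqn_leq im ltn_ord.
by rewrite modnn /= nth_default // -ltnS.
Qed.

(** * Total extensions as words starting at a fixed vertex *)

Section ExtensionSum.
Variables (K : fieldType) (n : nat) (a : 'I_n).

Lemma perm_punctured (w : seq 'I_n) : perm_eq w (enum (~: [set a])) ->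
  uniq (a :: w) /\ forall x, x \in a :: w.
Proof.
move=> pw; split=> [|x].
  by rewrite /= (perm_uniq pw) enum_uniq (perm_mem pw) mem_enum !inE eqxx.
by rewrite inE (perm_mem pw) mem_enum !inE orbN.
Qed.

(** The cycle word of a total order contains every vertex, so it can be rotated to start at [a]. *)
Lemma Ext_words C : Ext C = [set chain (a :: val w) |
  w : #|~: [set a]|.-tuple 'I_n & perm_eq w (enum (~: [set a])) &&
    (C \subset chain (a :: val w))].
Proof.
apply/setP=> D; rewrite inE; apply/andP/imsetP => [[totD CD]|[w]].
  have [uv vD] := cycle_wordP totD.
  have fv x : x \in val (cycle_word D).
    have := card_uniqP uv; rewrite size_tuple => cv.
    have /eqP/setP/(_ x) : [set y in val (cycle_word D)] == setT.
      rewrite eqEcard subsetT /= cardsT card_ord.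
      by rewrite -{1}cv; apply/eq_leq/eq_card => y; rewrite inE.
    by rewrite !inE.
  case: (rot_to (fv a)) => i w wE.
  have ua : uniq (a :: w) by rewrite -wE rot_uniq.
  have pw : perm_eq w (enum (~: [set a])).
    have /andP[aw uw] := ua.
    apply: uniq_perm; rewrite ?enum_uniq // => x; rewrite mem_enum !inE.
    have : x \in a :: w by rewrite -wE mem_rot.
    by rewrite inE; case: eqP => [->|//]; rewrite (negbTE aw).
  have sw : size w == #|~: [set a]| by rewrite (size_perm_enum pw).
  have wD : chain (a :: w) = D by rewrite -wE chain_rot.
  by exists (Tuple sw) => //; rewrite inE pw wD.
rewrite inE => /andP[/perm_punctured[uw fw] CD] ->; split=> //.
exact: chain_is_total.
Qed.

(** Each extension comes from a single word, so the sum runs over all words on the other vertices,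
    with an indicator for extending [C]. *)
Lemma Ext_sum C : \sum_(D in Ext C) PT K (cycle_word D) =
  word_sum (~: [set a]) (fun w =>
    (C \subset chain (a :: w))%:R * pt_path (plucker K (n := n)) a w a).
Proof.
rewrite Ext_words big_imset /=; last first.
  move=> w w'; rewrite !inE => /andP[pw _] /andP[pw' _] E.
  have [uw fw] := perm_punctured pw; have [uw' fw'] := perm_punctured pw'.
  apply: val_inj; apply: (chain_cons_inj uw uw' _ fw E) => x.
  by rewrite (perm_mem pw) (perm_mem pw').
rewrite /word_sum (eq_bigl _ _ (fun w => in_set _ w)) big_mkcondr /=.
apply: eq_bigr => w pw; have [uw fw] := perm_punctured pw.
case: ifP => _; last by rewrite mul0r.
have sw : size (a :: w) == n.
  apply/eqP; rewrite -(card_uniqP uw) -[RHS]card_ord.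
  by apply: eq_card => x; rewrite fw.
have [uv vD] := cycle_wordP (chain_is_total uw fw).
rewrite mul1r pt_pathV -(@prod_cyclic_tuple _ _ _ _ (Tuple sw)) //.
exact: (PT_chain K (v := cycle_word _) (w := Tuple sw)).
Qed.

End ExtensionSum.

(** * Splitting the constraints along the three arcs *)

Theorem theorem7p11 (R : realFieldType) (K : fieldType) (n : nat)
    (p : 'I_n -> 'rV[R]_2) (hp : clockwise_convex_polygon p)
    (tau : tricolored_subdivision p)
    (hgrey : exists2 A, A \in polygons tau & color_of tau A = Grey) :
  \sum_(D in Ext (subdivision_order tau)) PT K (cycle_word D) = 0.
Proof.
case: hgrey => A AT grey; have part := polygons_partition tau.
have [a [b [c [[aA bA cA] abc]]]] :
    exists a b c, [/\ a \in A, b \in A & c \in A] /\ clockwise a b c.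
  have [/(_ A AT)/card_gt2P[x [y [z [[xA yA zA] [xy yz zx]]]]] _ _] := part.
  have [h|h] : clockwise x y z \/ clockwise x z y.
  - by move: xy yz zx; rewrite -!val_eqE /clockwise /=; lia.
  - by exists x, y, z.
  - by exists x, z, y.
set C := subdivision_order tau.
(* Grey polygons impose no constraint, so the triple comes from a polygon other than [A], which lies
   in one arc. *)
have C_arcs x y z : (x, y, z) \in C ->
    [\/ [/\ in_arc a b x, in_arc a b y & in_arc a b z],
        [/\ in_arc b c x, in_arc b c y & in_arc b c z]
      | [/\ in_arc c a x, in_arc c a y & in_arc c a z]].
  case/bigcupP=> B BT xyzB.
  have AB : A != B.
    by apply: contraTneq xyzB => <-; rewrite grey inE.
  have [xB yB zB] : [/\ x \in B, y \in B & z \in B].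
    move: xyzB; rewrite /polygon_order; case: (color_of tau B); last by rewrite inE.
      by case/mem_chain_all; rewrite !mem_rev !mem_enum.
    by case/mem_chain_all; rewrite !mem_enum.
  case: (polygon_in_arc hp part AT BT AB aA bA cA abc) => h.
  - by apply: Or31; split; apply: h.
  - by apply: Or32; split; apply: h.
  - by apply: Or33; split; apply: h.
(* Words start at [a], so [a] is left out of the arcs ending at it; then [S1] meets [S3 :|: S2] in
   [b] only, and [S3] meets [S2] in [c] only. *)
pose S1 := [set x | (x != a) && in_arc a b x].
pose S2 := [set x | in_arc b c x].
pose S3 := [set x | (x != a) && in_arc c a x].
pose within (S : {set 'I_n}) (t : 'I_n * 'I_n * 'I_n) :=
  [&& t.1.1 \in S, t.1.2 \in S & t.2 \in S].
pose ok (S : {set 'I_n}) w := [forall t in C, within S t ==> (t \in chain w)].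
have ok_sub S w : ok S [seq x <- w | x \in S] =
    [forall t in C, within S t ==> (t \in chain w)].
  apply: eq_forallb_in => -[[x y] z] _; rewrite chain_filter /within /=.
  by case: (x \in S); case: (y \in S); case: (z \in S).
rewrite (Ext_sum K a).
have T_E : ~: [set a] = S1 :|: (S3 :|: S2).
  apply/setP=> x; rewrite !inE /in_arc -!val_eqE /=.
  by move: abc; rewrite /clockwise; lia.
(* The weights of the arcs at [a] put [a] back in front of the restricted word; the weight on [S2]
   sees only a chain, hence is invariant under rotation. *)
have := @word_sum_triangle0 _ _ (plucker K (n := n)) (@plucker_anti K n)
  (@plucker_relation K n) (@plucker_neq0 K n) S1 S2 S3 a b c
  (fun u => (ok (a |: S1) (a :: u))%:R) (fun u => (ok S2 u)%:R)
  (fun u => (ok (a |: S3) (a :: u))%:R).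
rewrite -T_E => <-.
(* By [C_arcs], the indicator of extending [C] is the product of the indicators of the three
   arcs. *)
- apply: eq_bigr => w /perm_punctured[ua _]; congr (_ * _).
  rewrite -!natrM !mulnb; congr (_%:R); congr nat_of_bool.
  have /andP[aw _] := ua.
  have filt (S : {set 'I_n}) :
      a :: [seq x <- w | x \in S] = [seq x <- a :: w | x \in a |: S].
    rewrite /= !inE eqxx /=; congr cons; apply: eq_in_filter => x xw.
    by rewrite !inE; case: eqP xw aw => // -> ->.
  have aS2 : a \notin S2.
    by rewrite inE /in_arc -!val_eqE /=; move: abc; rewrite /clockwise; lia.
  rewrite !filt (_ : [seq x <- w | x \in S2] = [seq x <- a :: w | x \in S2]);
    last by rewrite /= (negbTE aS2).
  rewrite !ok_sub; apply/subsetP/and3P => [sub|[/forall_inP h1 /forall_inP h3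
    /forall_inP h2] [[x y] z] xyzC].
    by split; apply/forall_inP => t /sub ->; rewrite implybT.
  have inS (S : {set 'I_n}) : x \in S -> y \in S -> z \in S -> within S (x, y, z).
    by move=> xS yS zS; apply/and3P.
  case: (C_arcs x y z xyzC) => -[hx hy hz].
  - by apply: (implyP (h1 _ xyzC)); apply: inS; rewrite !inE ?hx ?hy ?hz andbT orbN.
  - by apply: (implyP (h2 _ xyzC)); apply: inS; rewrite !inE.
  - by apply: (implyP (h3 _ xyzC)); apply: inS; rewrite !inE ?hx ?hy ?hz andbT orbN.
- by rewrite !inE eqxx.
- apply/setP=> x; rewrite !inE /in_arc -!val_eqE /=.
  by move: abc; rewrite /clockwise; lia.
- apply/setP=> x; rewrite !inE /in_arc -!val_eqE /=.
  by move: abc; rewrite /clockwise; lia.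
- by rewrite inE /in_arc eqxx.
- by apply: contraTneq abc => ->; rewrite /clockwise; lia.
- by move=> w; rewrite /ok chain_rot1.
Qed.
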